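(* Let $q\in[1,2]$, $L\ge 2$, $\lambda>0$, and $f\in C^1(\mathbb{R}^n,\mathbb{R})$. Let $w_{1,t},\dots,w_{L,t}\in\mathbb{R}^n$ solve the steepest flow (without weight decay) $$d w_{i,t}=-\operatorname{sign}(\nabla_{w_i}F(w_t))\odot|\nabla_{w_i}F(w_t)|^{q-1}dt,\quad i\in[L],\qquad F(w)=f\left(\textstyle\prod_{i=1}^L w_i\right),$$ with an initialization that is $\lambda$-$L_p$-balanced with respect to the first parameter, i.e. $|w_{j,0}|^q-|w_{1,0}|^q=\lambda\mathbf{1}_n$ for all $j\in\{2,\dots,L\}$. Then there is a separable function $R_{L_p,L}$, depending only on the initialization and the reparameterization, such that $x_t=\prod_{i=1}^L w_{i,t}$ satisfies, almost everywhere, the separable $L_p$ steepest mirror flow $$d\,\nabla_x R_{L_p,L}(x_t)=-\operatorname{sign}(\nabla_x f(x_t))\odot|\nabla_x f(x_t)|^{q-1}dt,\qquad x_0=\prod_{i=1}^L w_{i,0}.$$ Moreover $R_{L_p,L}$ is a separable Bregman and Legendre function when $q\frac{L-1}{L}\le 1$, and for $L=2$ its Hessian is the diagonal matrix $$\nabla^2_x R_{L_p,2}(x)=\operatorname{diag}\left(\frac{1}{\sqrt{4|x_i|^q+\lambda^2}}\right)_{i\in[n]}.$$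
   Context: All vector operations are entrywise; $\mathbf 1_n$ is the all-ones vector; $q$ is dual to $p$ ($1/p+1/q=1$). A function $R$ is separable if $R(x)=\sum_i R_i(x_i)$. Legendre function: a differentiable convex $R:\mathbb{R}^n\to\mathbb{R}\cup\{\infty\}$ that is strictly convex on the interior of its domain and such that $\|\nabla R(x_i)\|_{L_2}\to\infty$ along any sequence $x_i$ tending to the boundary of $\operatorname{dom}R$. Bregman divergence: $D_R(x_1,x_2)=R(x_1)-R(x_2)-\langle\nabla R(x_2),x_1-x_2\rangle$. Bregman function: $\operatorname{dom}R$ closed, $R$ strictly convex and continuous on $\operatorname{dom}R$ and $C^1$ on its interior; for every $x\in\operatorname{dom}R$ and $\gamma\in\mathbb{R}$ the set $\{y:D_R(x,y)\le\gamma\}$ is bounded; and $D_R(x,x_i)\to0$ whenever $x_i\to x$ with $x_i$ in the interior of the domain. *)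

(* Defs.v *)
From HB Require Import structures.
From mathcomp Require Import all_boot all_order all_algebra.
From mathcomp Require Import all_classical all_reals all_analysis.
Set Implicit Arguments. Unset Strict Implicit. Unset Printing Implicit Defensive.
Import Order.TTheory GRing.Theory Num.Theory.
Import numFieldNormedType.Exports.
Local Open Scope classical_set_scope.
Local Open Scope ring_scope.

Section Defs.
Context {R : realType} {n : nat}.

Definition e (k : 'I_n) : 'rV[R]_n := delta_mx 0 k.

Definition partial (k : 'I_n) (g : 'rV[R]_n -> R) (x : 'rV[R]_n) : R :=
  'D_(e k) g x.

Definition grad (g : 'rV[R]_n -> R) (x : 'rV[R]_n) : 'rV[R]_n :=
  \row_k partial k g x.

Definition C1 (g : 'rV[R]_n -> R) : Prop :=
  (forall x, differentiable g x) /\ (forall k, continuous (partial k g)).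

Definition hprod (L : nat) (ws : nat -> 'rV[R]_n) : 'rV[R]_n :=
  \row_k \prod_(i < L) ws i 0 k.

Definition gradF (f : 'rV[R]_n -> R) (L : nat) (ws : nat -> 'rV[R]_n) (i : nat)
  : 'rV[R]_n :=
  grad (fun v => f (hprod L (fun j => if j == i then v else ws j))) (ws i).

Definition steep (q : R) (g : 'rV[R]_n) : 'rV[R]_n :=
  \row_k (- (Num.sg (g 0 k) * `|g 0 k| `^ (q - 1))).

Definition separable (Rf : 'rV[R]_n -> R) : Prop :=
  exists Rk : 'I_n -> R -> R, forall x, Rf x = \sum_k Rk k (x 0 k).

Definition convex_fun (Rf : 'rV[R]_n -> R) : Prop :=
  forall x y (t : R), 0 <= t <= 1 ->
    Rf (t *: x + (1 - t) *: y) <= t * Rf x + (1 - t) * Rf y.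

Definition strictly_convex (Rf : 'rV[R]_n -> R) : Prop :=
  forall x y (t : R), x != y -> 0 < t < 1 ->
    Rf (t *: x + (1 - t) *: y) < t * Rf x + (1 - t) * Rf y.

Definition bregman_div (Rf : 'rV[R]_n -> R) (x1 x2 : 'rV[R]_n) : R :=
  Rf x1 - Rf x2 - \sum_k (grad Rf x2 0 k * (x1 0 k - x2 0 k)).

(* Legendre function, for a real-valued Rf (dom Rf = R^n, whose boundary is
   empty, so the gradient blow-up condition is vacuous) *)
Definition legendre (Rf : 'rV[R]_n -> R) : Prop :=
  (forall x, differentiable Rf x) /\ convex_fun Rf /\ strictly_convex Rf.

(* Bregman function, for a real-valued Rf (dom Rf = R^n, closed, equal to
   its interior) *)
Definition bregman_fun (Rf : 'rV[R]_n -> R) : Prop :=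
  strictly_convex Rf /\ continuous Rf /\
  (forall x, differentiable Rf x) /\ (forall k, continuous (partial k Rf)) /\
  (forall (x : 'rV[R]_n) (gamma : R), exists M : R,
      forall y, bregman_div Rf x y <= gamma -> forall k, `|y 0 k| <= M) /\
  (forall (x : 'rV[R]_n) (u : nat -> 'rV[R]_n),
      u @ \oo --> x -> (fun i => bregman_div Rf x (u i)) @ \oo --> 0).

End Defs.

Notation leb R := (@lebesgue_measure R).

(* Main.v *)
Require Import Defs.
From HB Require Import structures.
From mathcomp Require Import all_boot all_order all_algebra.
From mathcomp Require Import all_classical all_reals all_analysis.
From mathcomp Require Import measurable_realfun ring lra.
Set Implicit Arguments. Unset Strict Implicit. Unset Printing Implicit Defensive.
Import Order.TTheory GRing.Theory Num.Theory.
Import numFieldNormedType.Exports.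
Local Open Scope classical_set_scope.
Local Open Scope ring_scope.

(** The flow decouples over coordinates. Fix one, let [P_i] be the product of the
    factors other than [w_i] and [phi = - sign(g) |g|^(q-1)] with [g] the partial
    derivative of [f] at [x]. Then [w_i' = phi sign(P_i) |P_i|^(q-1)], so that
    [(|w_i|^q)' = q phi sign(x) |x|^(q-1)] does not depend on [i]: the balance
    [|w_j|^q = |w_1|^q + lambda] persists. Moreover [x' = sum_i P_i w_i' = phi H]
    with [H = sum_i |P_i|^q], and on the balanced set [H] is a continuous positive
    function of [x] alone, because [a = |w_1|^q] is the unique nonnegative root of
    [a (a + lambda)^(L-1) = |x|^q]. Hence any second primitive [r] of [1/H] satisfies
    [(r'(x))' = phi], and [R(x) = sum_k r(x_k)] is the potential. For [L = 2],
    [H = |w_1|^q + |w_2|^q = sqrt(4 |x|^q + lambda^2)]. If [q (L-1)/L <= 1] then [H]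
    grows at most linearly, so the Bregman divergence in [y], whose derivative is
    [(y - x)/H(y)], tends to infinity with [|y|].

    For [q = 1] the velocity [phi] is only bounded and measurable, so solutions are
    not differentiable; calculus is done with functions that are integrals of
    bounded measurable densities. *)

(** * Integrals of bounded densities *)

Section Density.
Context {R : realType}.
Notation mu := (@lebesgue_measure R).
Implicit Types (T M s t : R) (X Y a f F : R -> R).

Lemma lebesgue_measure_itv_bnd_fin (x y : bool) (a b : R) :
  (mu [set` Interval (BSide x a) (BSide y b)] < +oo)%E.
Proof.
by rewrite lebesgue_measure_itv /=; case: ifP => // _; rewrite -EFinD ltry.
Qed.

Lemma bounded_integrable_itvcc (a b M : R) f :
  measurable_fun `[a, b] f -> (forall s, a <= s <= b -> `|f s| <= M) ->
  mu.-integrable `[a, b] (EFin \o f).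
Proof.
move=> mf fM; apply: measurable_bounded_integrable => //.
- exact: lebesgue_measure_itv_bnd_fin.
- exists M; split; first exact: num_real.
  move=> N MN s /=; rewrite in_itv /= => /fM h.
  exact: le_trans h (ltW MN).
Qed.

Lemma ler_normr_Rintegral_itvoc (s t M : R) f : s <= t ->
  measurable_fun `[s, t] f -> (forall r, s <= r <= t -> `|f r| <= M) ->
  `|\int[mu]_(r in `]s, t]) f r| <= M * (t - s).
Proof.
move=> st mf fM.
have sub : `]s, t] `<=` `[s, t].
  by move=> r /=; rewrite !in_itv /= => /andP[/ltW -> ->].
have intf : mu.-integrable `]s, t] (EFin \o f).
  by apply: integrableS (bounded_integrable_itvcc mf fM).
have muE : fine (mu `]s, t]) = t - s.
  rewrite lebesgue_measure_itv /= lte_fin; case: ltP => //= ts.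
  by apply/esym/eqP; rewrite subr_eq0 eq_le ts st.
apply: (le_trans (le_normr_Rintegral _ intf)) => //.
rewrite -muE -(@Rintegral_cst _ _ _ mu) //.
apply: le_Rintegral => //.
- by move/integrable_norm: intf; apply: eq_integrable.
- apply: measurable_bounded_integrable => //.
    exact: lebesgue_measure_itv_bnd_fin.
  exists M; split; first exact: num_real.
  move=> N MN r /=; rewrite in_itv /= => /andP[sr rt].
  rewrite ger0_norm; first exact: ltW.
  by apply: le_trans (fM r _) => //; rewrite (ltW sr).
- by move=> r /=; rewrite in_itv /= => /andP[sr rt]; apply: fM; rewrite (ltW sr).
Qed.

(** Boundedness of [a], rather than mere integrability, makes [X] Lipschitz; the class is then
    stable under products and composition with C^1 functions. *)
Definition density T X a :=
  [/\ measurable_fun `[0, T] a,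
      exists M, forall s, 0 <= s <= T -> `|a s| <= M &
      forall t, 0 <= t <= T -> X t = X 0 + \int[mu]_(s in `[0, t]) a s].

Lemma sub_itvcc (a b c d : R) : c <= a -> b <= d -> `[a, b] `<=` `[c, d].
Proof.
move=> ca bd r /=; rewrite !in_itv /= => /andP[ar rb].
by rewrite (le_trans ca ar) (le_trans rb bd).
Qed.

Lemma density_integrable T X a t : density T X a -> 0 <= t <= T ->
  mu.-integrable `[0, t] (EFin \o a).
Proof.
move=> [ma [M aM] _] /andP[t0 tT].
apply: (@bounded_integrable_itvcc _ _ M).
  by apply: measurable_funS ma => //; apply: sub_itvcc.
by move=> s /andP[s0 st]; apply: aM; rewrite s0 (le_trans st).
Qed.

Lemma density_increment T X a s t : density T X a -> 0 <= s -> s <= t -> t <= T ->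
  X t - X s = \int[mu]_(r in `]s, t]) a r.
Proof.
move=> dX s0 st tT; have [_ _ XE] := dX.
rewrite XE ?(le_trans s0 st) // (XE s) ?s0 ?(le_trans st tT) //.
rewrite opprD addrACA subrr add0r.
have := @Rintegral_itvB _ a (BLeft 0) (BRight t) s.
rewrite /= => -> //.
by apply: density_integrable dX _; rewrite (le_trans s0 st).
Qed.

Lemma density_lipschitz T X a : density T X a ->
  exists2 M, 0 <= M & forall s t, 0 <= s <= T -> 0 <= t <= T ->
    `|X t - X s| <= M * `|t - s|.
Proof.
move=> dX; have [ma [M aM] _] := dX.
(* For [T < 0] the bound on [a] is vacuous and [M] may be negative. *)
exists `|M|; first exact: normr_ge0.
have aM' r : 0 <= r <= T -> `|a r| <= `|M|.
  by move=> /aM h; apply: le_trans h (ler_norm M).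
have key s t : 0 <= s -> s <= t -> t <= T -> `|X t - X s| <= `|M| * `|t - s|.
  move=> s0 st tT; rewrite (density_increment dX s0 st tT).
  rewrite (ger0_norm (_ : 0 <= t - s)) ?subr_ge0 //.
  apply: ler_normr_Rintegral_itvoc => //.
    by apply: measurable_funS ma => //; apply: sub_itvcc.
  by move=> r /andP[sr rt]; apply: aM'; rewrite (le_trans s0 sr) (le_trans rt tT).
move=> s t /andP[s0 sT] /andP[t0 tT].
have [st|/ltW ts] := leP s t; first exact: key.
by rewrite distrC (distrC t); exact: key.
Qed.

Lemma density_continuous T X a : density T X a ->
  {within `[0, T], continuous X}.
Proof.
move=> dX; have [M M0 XM] := density_lipschitz dX.
apply/subspace_continuousP => s /=; rewrite in_itv /= => sT.
apply/cvgrPdist_le => /= eps eps0.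
have M1 : 0 < M + 1 by lra.
rewrite near_withinE; near=> t => /=; rewrite in_itv /= => tT.
apply: le_trans (XM _ _ tT sT) _.
have : `|s - t| < eps / (M + 1).
  near: t; apply: nbhsx_ballx => //; exact: divr_gt0.
rewrite ltr_pdivlMr // => h.
apply: le_trans (_ : `|s - t| * (M + 1) <= _); last exact: ltW.
by rewrite mulrC ler_wpM2l //; lra.
Unshelve. all: by end_near. Qed.

Lemma continuous_itvcc_bounded T X : {within `[0, T], continuous X} ->
  exists M, forall s, 0 <= s <= T -> `|X s| <= M.
Proof.
move=> cX; have [T0|T0] := leP 0 T; last first.
  by exists 0 => s /andP[s0 sT]; have := le_trans s0 sT; rewrite leNgt T0.
have cN : {within `[0, T], continuous (fun s => `|X s|)}.
  by move=> s; apply: cvg_norm; exact: cX.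
have [c _ cmax] := EVT_max T0 cN.
by exists `|X c| => s sT; apply: cmax; rewrite in_itv.
Qed.

(* Extending [F] by constants outside [0, T] makes its derivative vanish on the whole line. *)
Lemma eq_of_superlinear_increments T F : 0 <= T ->
  (forall s, 0 <= s <= T -> forall eps, 0 < eps -> exists2 d, 0 < d &
     forall t, 0 <= t <= T -> `|t - s| < d -> `|F t - F s| <= eps * `|t - s|) ->
  F T = F 0.
Proof.
move=> T0 HF.
pose cl t : R := Num.max 0 (Num.min t T).
have cl_itv t : 0 <= cl t <= T.
  by rewrite /cl /Num.max /Num.min; do !case: ifPn => //=; rewrite ?ltNge ?negbK; lra.
have cl_lip s t : `|cl t - cl s| <= `|t - s|.
  wlog ts : s t / s <= t.
    move=> H; have [st|/ltW st] := leP s t; first exact: H.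
    by rewrite distrC (distrC t); apply: H.
  rewrite (@ger0_norm _ (t - s)) ?subr_ge0 //.
  rewrite /cl /Num.max /Num.min ler_norml.
  by do !case: ifPn => //=; rewrite -?leNgt; lra.
have cl0 : cl 0 = 0 by rewrite /cl min_l // maxxx.
have clT : cl T = T by rewrite /cl minxx max_r.
suff dF s : is_derive s 1 (F \o cl) 0.
  by have /= := is_derive_0_is_cst T 0 dF; rewrite cl0 clT.
have H : h^-1 *: ((F \o cl \o shift s) (h *: 1) - (F \o cl) s) @[h --> 0^'] --> (0 : R).
  apply/cvgrPdist_le => /= eps eps0.
  have [d d0 Hd] := HF (cl s) (cl_itv s) eps eps0.
  near=> h; rewrite sub0r normrN normrM normfV ler_pdivrMl; last first.
    by rewrite normr_gt0; near: h; exact: nbhs_dnbhs_neq.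
  have hs : `|cl (h *: 1 + s) - cl s| <= `|h|.
    by apply: le_trans (cl_lip _ _) _; rewrite scaler1 addrK.
  rewrite mulrC; apply: le_trans (Hd _ (cl_itv _) _) _.
    apply: le_lt_trans hs _.
    by near: h; apply: dnbhs0_lt.
  by rewrite ler_wpM2l // ltW.
by split; [apply/cvg_ex; exists 0|exact/cvg_lim].
Unshelve. all: by end_near. Qed.

End Density.

(** * Chain and product rules for densities *)

Section DensityCalculus.
Context {R : realType}.
Notation mu := (@lebesgue_measure R).
Implicit Types (T M s t c d : R) (X Y a b F P p : R -> R).

Lemma is_derive1_continuous F (df : R -> R) : (forall y : R, is_derive y 1 F (df y)) ->
  continuous F.
Proof.
by move=> dF y; apply/differentiable_continuous/derivable1_diffP; have [] := dF y.
Qed.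

Lemma is_derive1_sqr (y : R) : is_derive y 1 (fun z : R => z ^+ 2) (2 * y).
Proof.
have -> : (fun z : R => z ^+ 2) = (id : R -> R) * id by apply/funext => z; rewrite expr2.
apply: is_derive_eq (is_deriveM (is_derive_id y 1) (is_derive_id y 1)) _.
by rewrite /GRing.scale /= mulr1; ring.
Qed.

(** The order of [u] and [v] is left open; the strict position of [c] later gives strict positivity
    of the Bregman divergence. *)
Lemma MVT_line_strict F (df : R -> R) (u v : R) :
  (forall y : R, is_derive y 1 F (df y)) -> u != v ->
  exists2 c, (u < c < v) || (v < c < u) & F v - F u = df c * (v - u).
Proof.
move=> dF uv; have cF := is_derive1_continuous dF.
have mvt (a b : R) : a < b -> exists2 c, a < c < b & F b - F a = df c * (b - a).
  move=> ab; have [//|c] := @MVT _ F df a b ab (fun x _ => dF x).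
    exact: continuous_subspaceT.
  by rewrite in_itv /= => cab H; exists c.
have [/mvt[c cuv H]|/mvt[c cuv H]|/eqP] := ltgtP u v; last by rewrite (negPf uv).
  by exists c; rewrite ?cuv.
by exists c; rewrite ?cuv ?orbT // -opprB H -mulrN opprB.
Qed.

Lemma MVT_line F (df : R -> R) (u v : R) : (forall y : R, is_derive y 1 F (df y)) ->
  exists2 c, (u <= c <= v) || (v <= c <= u) & F v - F u = df c * (v - u).
Proof.
move=> dF; have [->|uv] := eqVneq u v.
  by exists v; rewrite ?lexx // !subrr mulr0.
have [c cuv H] := MVT_line_strict dF uv; exists c => //.
by case/orP: cuv => /andP[/ltW -> /ltW ->]; rewrite ?orbT.
Qed.

Lemma density_lin T X Y a b c d : density T X a -> density T Y b ->
  density T (fun t => c * X t + d * Y t) (fun s => c * a s + d * b s).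
Proof.
move=> dX dY; have [ma [M aM] XE] := dX; have [mb [N bN] YE] := dY.
split.
- by apply: measurable_funD; apply: measurable_funM.
- exists (`|c| * M + `|d| * N) => s sT.
  apply: le_trans (ler_normD _ _) _; rewrite !normrM.
  by apply: lerD; apply: ler_wpM2l; rewrite ?normr_ge0 ?aM ?bN.
- move=> t tT; have ia := density_integrable dX tT.
  have ib := density_integrable dY tT.
  rewrite RintegralD //; last 2 first.
  + by apply: eq_integrable (integrableZl _ c ia) => // s _.
  + by apply: eq_integrable (integrableZl _ d ib) => // s _.
  by rewrite !RintegralZl // (XE t) // (YE t) //; ring.
Qed.

Lemma density_Rintegral T b : measurable_fun `[0, T] b ->
  (exists M, forall s, 0 <= s <= T -> `|b s| <= M) ->
  density T (fun t => \int[mu]_(s in `[0, t]) b s) b.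
Proof.
by move=> mb bM; split=> // t _; rewrite set_itv1 Rintegral_set1 add0r.
Qed.

Lemma density_ext T X Y a b : density T X a ->
  (forall t, 0 <= t <= T -> Y t = X t) ->
  (forall t, 0 <= t <= T -> b t = a t) -> density T Y b.
Proof.
move=> [ma [M aM] XE] YX ba; split.
- apply: eq_measurable_fun ma => s; rewrite inE /= in_itv /= => sT.
  by rewrite ba.
- by exists M => s sT; rewrite ba // aM.
- move=> t /andP[t0 tT]; rewrite !YX ?t0 ?lexx ?(le_trans t0 tT) //.
  rewrite XE ?t0 //; congr (_ + _); apply: eq_Rintegral => s.
  by rewrite inE /= in_itv /= => /andP[s0 st]; rewrite ba // s0 (le_trans st).
Qed.

Lemma within_continuous_measurable T X : {within `[0, T], continuous X} ->
  measurable_fun `[0, T] X.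
Proof. by move=> cX; apply: subspace_continuous_measurable_fun. Qed.

Lemma bounded_mul_continuous T b a :
  {within `[0, T], continuous b} ->
  (exists M, forall s, 0 <= s <= T -> `|a s| <= M) ->
  exists M, forall s, 0 <= s <= T -> `|b s * a s| <= M.
Proof.
move=> /continuous_itvcc_bounded[N bN] [M aM].
exists (N * M) => s sT; rewrite normrM.
by apply: ler_pM; rewrite ?normr_ge0 ?aM ?bN.
Qed.

(* The density need not be continuous, so [P \o X] may fail to be differentiable;
   but [P \o X] minus the integral of [p (X s) * a s] has derivative zero at every
   point, because [p \o X] is continuous and [a] bounded. *)
Lemma density_comp T X a P p : density T X a ->
  (forall y : R, is_derive y 1 P (p y)) -> continuous p ->
  density T (P \o X) (fun s => p (X s) * a s).
Proof.
move=> dX dP cp; have [ma aM _] := dX.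
have cX := density_continuous dX.
have cpX : {within `[0, T], continuous (p \o X)}.
  by move=> s; apply: (cvg_comp _ _ (cX s)); exact: cp.
have mb : measurable_fun `[0, T] (fun s => p (X s) * a s).
  by apply: measurable_funM => //; exact: within_continuous_measurable.
have bM := bounded_mul_continuous cpX aM.
split => //.
have dI := density_Rintegral mb bM.
set I := (fun t : R => _) in dI.
pose F t := P (X t) - I t.
suff FE t : 0 <= t <= T -> F t = F 0.
  move=> t tT; move: (FE t tT); rewrite /F {2}/I set_itv1 Rintegral_set1 subr0.
  by move=> H; rewrite /= -H subrK.
move=> /andP[t0 tT]; apply: eq_of_superlinear_increments => // s /andP[s0 st] eps eps0.
have sT : 0 <= s <= T by rewrite s0 (le_trans st).
have [K K0 XK] := density_lipschitz dX.
have {aM} [M M0 aM] : exists2 M, 0 <= M & forall s, 0 <= s <= T -> `|a s| <= M.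
  case: aM => M aM; exists `|M| => // r /aM h; exact: le_trans h (ler_norm M).
(* Both [p c] and [p (X r)] will be compared with [p (X s)], hence the factor 2; the difference is
   then multiplied by [a r], of size at most [M]. *)
have e1 : 0 < eps / (2 * (M + 1)) by apply: divr_gt0 => //; lra.
have /cvgrPdist_lt /(_ _ e1) /nbhs_ballP[eta /= eta0 Heta] := cp (X s).
exists (eta / (K + 1)); first by apply: divr_gt0 => //; lra.
have near_X r : 0 <= r <= T -> `|r - s| < eta / (K + 1) -> `|X r - X s| < eta.
  rewrite ltr_pdivlMr; last lra.
  move=> rT rs; apply: le_lt_trans (XK _ _ sT rT) _.
  by apply: le_lt_trans rs; rewrite mulrC ler_wpM2l //; lra.
have near_p z : `|z - X s| < eta -> `|p z - p (X s)| < eps / (2 * (M + 1)).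
  by move=> h; rewrite distrC; apply: Heta; rewrite /ball /= distrC.
(* The mean value theorem turns the increment of [P \o X] into [p c] times that of [X]. So
   [F v - F u] is the integral of [(p c - p (X r)) * a r], where [c] and all [X r] are within [eta]
   of [X s]. *)
have key u v : 0 <= u -> u <= v -> v <= T -> `|u - s| < eta / (K + 1) ->
    `|v - s| < eta / (K + 1) -> `|F v - F u| <= eps * `|v - u|.
  move=> u0 uv vT us vs.
  have uT : 0 <= u <= T by rewrite u0 (le_trans uv).
  have vT' : 0 <= v <= T by rewrite (le_trans u0 uv).
  have [c cuv PE] := MVT_line (X u) (X v) dP.
  have cs : `|c - X s| < eta.
    have := near_X _ uT us; have := near_X _ vT' vs; rewrite !ltr_norml.
    by case/orP: cuv; lra.
  have dY := density_lin (p c) (-1) dX dI.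
  have FE : F v - F u = (p c * X v + -1 * I v) - (p c * X u + -1 * I u).
    by rewrite /F; move/eqP: PE; rewrite subr_eq => /eqP ->; ring.
  rewrite FE (density_increment dY u0 uv vT) (@ger0_norm _ (v - u)) ?subr_ge0 //.
  apply: ler_normr_Rintegral_itvoc => //.
    by have [mY _ _] := dY; apply: measurable_funS mY => //; apply: sub_itvcc.
  move=> r /andP[ur rv].
  have rT : 0 <= r <= T by rewrite (le_trans u0 ur) (le_trans rv).
  have rs : `|r - s| < eta / (K + 1).
    by move: us vs; rewrite !ltr_norml; lra.
  rewrite (_ : _ + _ = (p c - p (X r)) * a r); last by ring.
  rewrite normrM.
  have h1 : `|p c - p (X r)| <= eps / (M + 1).
    have := near_p _ cs; have := near_p _ (near_X _ rT rs).
    have -> : eps / (M + 1) = eps / (2 * (M + 1)) + eps / (2 * (M + 1)).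
      by field; lra.
    move=> a1 a2; rewrite (_ : p c - _ = (p c - p (X s)) - (p (X r) - p (X s))); last by ring.
    by apply: le_trans (ler_normB _ _) _; apply: lerD; apply: ltW.
  apply: le_trans (_ : eps / (M + 1) * M <= _).
    by apply: ler_pM; rewrite ?normr_ge0 ?aM.
  rewrite mulrAC ler_pdivrMr; last lra.
  by rewrite ler_wpM2l //; lra.
have ss : `|s - s| < eta / (K + 1).
  by rewrite subrr normr0; apply: divr_gt0 => //; lra.
move=> r /andP[r0 rt] rs.
have [sr|/ltW rs'] := leP s r; first by apply: key => //; exact: le_trans tT.
by rewrite distrC (distrC r); apply: key => //; case/andP: sT.
Qed.

(* Polarization: [X * Y = (X + Y)^2 / 4 - (X - Y)^2 / 4]. *)
Lemma densityM T X Y a b : density T X a -> density T Y b ->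
  density T (fun t => X t * Y t) (fun s => X s * b s + Y s * a s).
Proof.
move=> dX dY.
have dsq Z z : density T Z z -> density T (fun t => Z t ^+ 2) (fun s => (2 * Z s) * z s).
  move=> dZ; apply: (@density_comp T Z z (fun y => y ^+ 2) (fun y => 2 * y)) => //.
    exact: is_derive1_sqr.
  by move=> y; apply: cvgM; [exact: cvg_cst|exact: cvg_id].
have d1 := dsq _ _ (density_lin 1 1 dX dY).
have d2 := dsq _ _ (density_lin 1 (-1) dX dY).
by apply: density_ext (density_lin 4^-1 (- 4^-1) d1 d2) _ _ => t _; field.
Qed.

Lemma density_cst T c : density T (fun=> c) (fun=> 0).
Proof.
split; first exact: measurable_cst.
  by exists 0 => s _; rewrite normr0.
by move=> t _; rewrite Rintegral_cst // mul0r addr0.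
Qed.

Lemma density_prod T (X a : nat -> R -> R) m :
  (forall i, (i < m)%N -> density T (X i) (a i)) ->
  density T (fun t => \prod_(i < m) X i t)
    (fun s => \sum_(i < m) (\prod_(j < m | j != i) X j s) * a i s).
Proof.
elim: m => [_|m IH dX].
  apply: density_ext (density_cst T 1) _ _ => t _; first by rewrite big_ord0.
  by rewrite big_ord0.
have dm := IH (fun i im => dX i (ltnW im)).
apply: density_ext (densityM dm (dX m (ltnSn m))) _ _ => t _.
  by rewrite big_ord_recr.
rewrite big_ord_recr /= addrC; congr (_ + _).
  congr (_ * _); rewrite big_mkcond big_ord_recr /= eqxx mulr1.
  by apply: eq_bigr => i _; rewrite -val_eqE /= ltn_eqF.
rewrite mulr_sumr; apply: eq_bigr => i _; rewrite mulrA; congr (_ * _).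
rewrite [LHS]big_mkcond big_ord_recr /= -[X in _ * X]/(if ord_max != widen_ord _ i then _ else _).
rewrite -val_eqE /= gtn_eqF //= mulrC; congr (_ * _).
rewrite [RHS]big_mkcond; apply: eq_bigr => j _.
by rewrite -!val_eqE.
Qed.

End DensityCalculus.

(** * Powers of absolute values *)

Section SignedPower.
Context {R : realType}.
Implicit Types (r x y q c : R).

(** Minus [spow (q - 1)] is the entrywise map in [steep]. The sign factor forces the value 0 at
    [y = 0], even for [r = 0], where the power of 0 is 1. *)
Definition spow r y : R := Num.sg y * `|y| `^ r.

(** Multiplicativity separates the contribution of [f] from that of the other factors in the
    velocity of each [w i]. *)
Lemma spowM r x y : spow r (x * y) = spow r x * spow r y.
Proof. by rewrite /spow sgrM normrM powRM ?normr_ge0 //; ring. Qed.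

Lemma mulr_spow q y : 0 < q -> y * spow (q - 1) y = `|y| `^ q.
Proof.
move=> q0; rewrite /spow mulrA (mulrC y) -normrEsg.
have [->|y0] := eqVneq y 0; first by rewrite normr0 mul0r powR0 ?gt_eqF.
rewrite -{1}(@powRr1 _ `|y|) // -powRD ?normr_eq0 ?y0 ?implybT //.
by rewrite addrC subrK.
Qed.

(** Equality fails at [r = 0], [y = 0], where the sides are 0 and 1. *)
Lemma normr_spow_le r y : `|spow r y| <= `|y| `^ r.
Proof.
rewrite /spow normrM normr_sg (ger0_norm (powR_ge0 _ _)).
by case: (y != 0); rewrite ?mul1r // mul0r powR_ge0.
Qed.

(** At [r = 0] this is the discontinuous sign function, whose measurability comes from
    monotonicity. *)
Lemma measurable_spow r : measurable_fun setT (spow r).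
Proof.
apply: measurable_funM.
  apply: nondecreasing_measurable => // x y xy.
  by case: (sgrP x) xy; case: (sgrP y) => //=; lra.
by apply: (@measurableT_comp _ _ _ _ _ _ (@powR R ^~ r)) => //; exact: normr_measurable.
Qed.

Lemma continuous_powR_gt0 r x : 0 < x -> {for x, continuous (@powR R ^~ r)}.
Proof.
move=> x0; apply/differentiable_continuous/derivable1_diffP.
by have [] := is_derive1_powR r x0.
Qed.

Lemma continuous_normr_powR r : 0 < r -> continuous (fun y : R => `|y| `^ r).
Proof.
move=> r0 y; have [->|y0] := eqVneq y 0; last first.
  apply: (@continuous_comp R R R (@Num.norm R R) (@powR R ^~ r) y).
    exact: (@norm_continuous _ R y).
  by apply: continuous_powR_gt0; rewrite normr_gt0.
apply/cvgrPdist_le => eps eps0; apply/nbhs_ballP.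
(* This radius is the preimage of [eps] under the power [r]. *)
exists (eps `^ r^-1) => /=; first exact: powR_gt0.
move=> z; rewrite /ball /= sub0r normrN => zlt.
rewrite normr0 powR0 ?gt_eqF // sub0r normrN (ger0_norm (powR_ge0 _ _)).
have -> : eps = (eps `^ r^-1) `^ r.
  by rewrite -powRrM mulVf ?gt_eqF // powRr1 // ltW.
by apply: ge0_ler_powR; rewrite ?nnegrE ?powR_ge0 // ltW.
Qed.

Lemma sqr_powR r y : (y ^+ 2) `^ r = `|y| `^ (2 * r).
Proof. by rewrite powRrM powR_mulrn // real_normK // num_real. Qed.

Lemma sqr_powR_half r y : (y ^+ 2) `^ (r / 2) = `|y| `^ r.
Proof. by rewrite sqr_powR mulrC divfK. Qed.

(** * Smooth approximation of powers of the absolute value *)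

Section Smoothing.
Variable q : R.
Hypothesis q_ge1 : 1 <= q.

(* [sqrt (y^2 + c) ^ q], a smooth approximation of [|y|^q] as [c] tends to [0]. *)
Definition smooth_pow c y : R := (y ^+ 2 + c) `^ (q / 2).
Definition smooth_pow' c y : R := q * ((y ^+ 2 + c) `^ (q / 2 - 1) * y).

Lemma is_derive_sqrD c y : is_derive y 1 (fun z : R => z ^+ 2 + c) (2 * y).
Proof.
apply: is_derive_eq (is_deriveD (is_derive1_sqr y) (is_derive_cst c y 1)) _.
by rewrite addr0.
Qed.

Lemma sqrD_gt0 c y : 0 < c -> 0 < y ^+ 2 + c.
Proof. by move=> c0; rewrite ltr_wpDl // sqr_ge0. Qed.

Lemma is_derive_smooth_pow c y : 0 < c ->
  is_derive y 1 (smooth_pow c) (smooth_pow' c y).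
Proof.
move=> c0; have yc := sqrD_gt0 y c0.
rewrite (_ : smooth_pow c = (@powR R ^~ (q / 2)) \o (fun z => z ^+ 2 + c)) //.
have d1 := is_derive1_powR (q / 2) yc.
have d2 := @is_derive1_comp R _ (fun z => z ^+ 2 + c) y _ _ d1 (is_derive_sqrD c y).
apply: is_derive_eq d2 _.
by rewrite /smooth_pow'; field.
Qed.

Lemma continuous_smooth_pow' c : 0 < c -> continuous (smooth_pow' c).
Proof.
move=> c0 y; apply: cvgM; first exact: cvg_cst.
apply: cvgM; last exact: cvg_id.
apply: (@continuous_comp R R R (fun z => z ^+ 2 + c) (@powR R ^~ (q / 2 - 1)) y).
  exact: (is_derive1_continuous (is_derive_sqrD c)).
exact: continuous_powR_gt0 (sqrD_gt0 y c0).
Qed.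

Lemma cvg_sqrD_harmonic y : y ^+ 2 + harmonic n @[n --> \oo] --> y ^+ 2.
Proof. by rewrite -[X in _ --> X]addr0; apply: cvgD; [exact: cvg_cst|exact: cvg_harmonic]. Qed.

Lemma smooth_pow_cvg y : smooth_pow (harmonic n) y @[n --> \oo] --> `|y| `^ q.
Proof.
have q2 : 0 < q / 2 by move: q_ge1; lra.
rewrite -sqr_powR_half -[X in X `^ _](@ger0_norm _ (y ^+ 2)) ?sqr_ge0 //.
rewrite (_ : (fun n => _) = (fun z => `|z| `^ (q / 2)) \o (fun n => y ^+ 2 + harmonic n)).
  apply: (@continuous_cvg _ R R _ _ _ (fun z => `|z| `^ (q / 2))).
    exact: continuous_normr_powR.
  exact: cvg_sqrD_harmonic.
apply/funext => n /=; rewrite ger0_norm //.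
by apply/ltW/sqrD_gt0/harmonic_gt0.
Qed.

(** At [y = 0] the factor [y] kills every term, in agreement with the value 0 of [spow] there; so
    the limit is right even for [q = 1], where the absolute value has no derivative. *)
Lemma smooth_pow'_cvg y :
  smooth_pow' (harmonic n) y @[n --> \oo] --> q * spow (q - 1) y.
Proof.
apply: cvgM; first exact: cvg_cst.
have [->|y0] := eqVneq y 0.
  rewrite /spow sgr0 mul0r (_ : (fun n => _) = (fun=> 0)); first exact: cvg_cst.
  by apply/funext => n; rewrite mulr0.
rewrite (_ : spow _ _ = (y ^+ 2) `^ (q / 2 - 1) * y).
  apply: cvgM; last exact: cvg_cst.
  apply: (@continuous_cvg _ R R _ _ _ (@powR R ^~ (q / 2 - 1))).
    by apply: continuous_powR_gt0; rewrite exprn_even_gt0.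
  exact: cvg_sqrD_harmonic.
rewrite sqr_powR /spow.
transitivity (Num.sg y * (`|y| `^ (2 * (q / 2 - 1)) * `|y|)); last first.
  by rewrite mulrCA mulr_sg_norm.
congr (_ * _); transitivity (`|y| `^ (2 * (q / 2 - 1)) * `|y| `^ 1); last by rewrite powRr1.
by rewrite -powRD ?normr_eq0 ?y0 ?implybT //; congr (_ `^ _); field.
Qed.

(** A bound uniform in [c], for dominated convergence: estimating [|y|] by the square root of
    [y ^+ 2 + c] raises the possibly negative exponent [q / 2 - 1] to [(q - 1) / 2], which is
    nonnegative. *)
Lemma normr_smooth_pow'_le c y (B : R) : 0 < c <= 1 -> `|y| <= B ->
  `|smooth_pow' c y| <= q * (B ^+ 2 + 1) `^ ((q - 1) / 2).
Proof.
move=> /andP[c0 c1] yB; have yc := sqrD_gt0 y c0.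
have q0 : 0 <= q by exact: le_trans q_ge1.
rewrite normrM (@ger0_norm _ q) //.
apply: ler_wpM2l => //.
rewrite normrM (ger0_norm (powR_ge0 _ _)).
have h1 : `|y| <= (y ^+ 2 + c) `^ 2^-1.
  by rewrite (powR12_sqrt (ltW yc)) -sqrtr_sqr ler_wsqrtr // lerDl ltW.
apply: le_trans (ler_wpM2l (powR_ge0 _ _) h1) _.
rewrite -powRD ?(gt_eqF yc) ?implybT //.
rewrite (_ : q / 2 - 1 + 2^-1 = (q - 1) / 2); last by field.
apply: ge0_ler_powR; rewrite ?nnegrE ?(ltW yc) //; first by move: q_ge1; lra.
  by rewrite addr_ge0 // sqr_ge0.
apply: lerD => //; rewrite -(real_normK (num_real y)).
by apply: lerXn2r; rewrite ?nnegrE // (le_trans _ yB).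
Qed.

End Smoothing.

(* The chain rule for the merely Lipschitz function [|.|^q] (at [q = 1]), by
   smoothing and dominated convergence. *)
Lemma density_normr_powR T (X a : R -> R) q : 1 <= q -> density T X a ->
  density T (fun t => `|X t| `^ q) (fun s => q * spow (q - 1) (X s) * a s).
Proof.
move=> q1 dX; have [ma [M aM] _] := dX.
have q0 : 0 <= q - 1 by lra.
have cX := density_continuous dX.
have mX := within_continuous_measurable cX.
have [B XB] := continuous_itvcc_bounded cX.
have mb : measurable_fun `[0, T] (fun s => q * spow (q - 1) (X s) * a s).
  apply: measurable_funM => //; apply: measurable_funM => //.
  exact: (measurableT_comp (measurable_spow _)).
split => //.
  exists (q * B `^ (q - 1) * M) => s sT; rewrite normrM (normrM q).
  apply: ler_pM; [by rewrite mulr_ge0|by []| |exact: aM].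
  rewrite (@ger0_norm _ q); last lra.
  apply: ler_wpM2l; first lra.
  apply: le_trans (normr_spow_le _ _) _.
  by apply: ge0_ler_powR; rewrite ?nnegrE ?(le_trans _ (XB s sT)) ?XB.
move=> t tT; have [t0 tT'] := andP tT.
have sub : `[0, t] `<=` `[0, T] by exact: sub_itvcc.
have dn n := density_comp dX
  (fun y => is_derive_smooth_pow q y (@harmonic_gt0 R n))
  (continuous_smooth_pow' (q := q) (@harmonic_gt0 R n)).
pose C := q * (B ^+ 2 + 1) `^ ((q - 1) / 2) * M.
have [||||| ilim _] := @dominated_convergence _ _ R (@lebesgue_measure R) `[0, t]
  (measurable_itv _)
  (fun n => EFin \o (fun s => smooth_pow' q (harmonic n) (X s) * a s))
  (EFin \o (fun s => q * spow (q - 1) (X s) * a s)) (EFin \o cst C).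
- move=> n; have [mn _ _] := dn n.
  by apply/measurable_EFinP; exact: measurable_funS mn.
- by apply/measurable_EFinP; exact: measurable_funS mb.
- apply: aeW => s st; apply: cvg_EFin; first exact: nearW.
  apply: cvgM; last exact: cvg_cst.
  exact: smooth_pow'_cvg.
- apply: (@bounded_integrable_itvcc _ _ _ `|C|); first exact: measurable_cst.
  by [].
- apply: aeW => s n st; rewrite /= lee_fin normrM.
  have sT : 0 <= s <= T by have := sub _ st; rewrite /= in_itv.
  apply: ler_pM; rewrite ?normr_ge0 ?aM //.
  apply: normr_smooth_pow'_le; rewrite ?XB // harmonic_gt0 /=.
  by rewrite invf_le1 // ler1n.
rewrite -[X in _ --> X]fineK; last exact: integrable_fin_num.
move=> /fine_cvg H.
(* The integral identity holds for every smoothed power, and both of its sides converge; uniqueness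
   of limits concludes. *)
have H0 := cvgD (@smooth_pow_cvg q q1 (X 0)) H.
have Ht := @smooth_pow_cvg q q1 (X t).
rewrite -[LHS](cvg_lim _ Ht) // -[RHS](cvg_lim _ (H0 _)) //.
set g := (X in _ = lim (X @ _)).
have -> : (fun n => smooth_pow q (harmonic n) (X t)) = g; last by [].
rewrite /g.
apply/funext => n.
by have [_ _ /(_ t tT) /=] := dn n.
Qed.

End SignedPower.

(** * The speed of the product on the balanced set *)

Section Primitive.
Context {R : realType}.
Notation mu := (@lebesgue_measure R).

Lemma continuous_integrable_itvcc (g : R -> R) (a b : R) : continuous g ->
  mu.-integrable `[a, b] (EFin \o g).
Proof.
move=> cg; apply: continuous_compact_integrable; first exact: segment_compact.
exact: continuous_subspaceT.
Qed.

(** Integrals start at a base point [- M] to the left of [x]. Subtracting the integral up to 0 makes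
    the value independent of [M], so the base point may vary with [x]. *)
Lemma continuous_primitive (g : R -> R) : continuous g ->
  exists G : R -> R, forall x : R, is_derive x 1 G (g x).
Proof.
move=> cg.
have ig a b := continuous_integrable_itvcc a b cg.
pose Th (M x : R) := \int[mu]_(t in `[- M, x]) g t - \int[mu]_(t in `[- M, 0]) g t.
have splitE M N x : M <= N -> - M <= x -> \int[mu]_(t in `[- N, x]) g t =
    \int[mu]_(t in `[- N, - M]) g t + \int[mu]_(t in `[- M, x]) g t.
  move=> MN Mx; rewrite -(@Rintegral_itv_obnd_cbnd _ (- M)); last first.
    apply: integrableS (ig (- M) x) => // t /=.
    by rewrite !in_itv /= => /andP[/ltW -> ->].
  rewrite -(@Rintegral_itvB _ g (BLeft (- N)) (BRight x) (- M)) ?bnd_simp ?lerN2 //.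
  by rewrite addrC subrK.
have ThE M N x : 0 <= M -> M <= N -> - M <= x -> Th N x = Th M x.
  by move=> M0 MN Mx; rewrite /Th (splitE M N x) // (splitE M N 0) ?oppr_le0 //; ring.
exists (fun x => Th (`|x| + 2) x) => x.
(* For [y] within 1 of [x], [|y| + 2] stays below [|x| + 4], so a single base point serves near [x]
   and the fundamental theorem applies. *)
apply: (@near_eq_is_derive _ _ _ (Th (`|x| + 4))).
  near=> y.
  have xy : `|x - y| < 1 by near: y; exact: nbhsx_ballx.
  have yx : `|y| <= `|x| + 1.
    rewrite -[y](subrK x) addrC; apply: le_trans (ler_normD _ _) _.
    by rewrite lerD2l distrC ltW.
  apply: ThE; [by rewrite addr_ge0|by move: yx; lra|].
  by have := ler_norm (- y); rewrite normrN; lra.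
have xu : x < x + 1 by rewrite ltrDl.
have ax : - (`|x| + 4) < x by have := ler_norm (- x); rewrite normrN; lra.
have [dF FE] := continuous_FTC1_closed xu (ig _ _) ax (cg x).
have dF' : is_derive x 1 (fun y => \int[mu]_(t in `[- (`|x| + 4), y]) g t) (g x).
  by split => //; rewrite -derive1E FE.
apply: is_derive_eq (is_deriveB dF'
  (is_derive_cst (\int[mu]_(t in `[- (`|x| + 4), 0]) g t) x 1)) _.
by rewrite subr0.
Unshelve. all: by end_near. Qed.

End Primitive.

Section MirrorSpeed.
Context {R : realType}.
Variables (lam q : R) (N : nat).
Hypotheses (lam_gt0 : 0 < lam) (q_ge1 : 1 <= q).
Implicit Types (a b x y : R).

Let prof a : R := a * (a + lam) ^+ N.

(** The profile has slope at least [lam ^+ N] on the nonnegative half-line; existence, uniqueness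
    and continuity of its inverse all rest on this. *)
Lemma profile_increase a b : 0 <= b -> b <= a -> (a - b) * lam ^+ N <= prof a - prof b.
Proof.
move=> b0 ba; have a0 := le_trans b0 ba.
have h1 : (b + lam) ^+ N <= (a + lam) ^+ N.
  by apply: lerXn2r; rewrite ?nnegrE ?addr_ge0 ?(ltW lam_gt0) // lerD2r.
have h2 : lam ^+ N <= (b + lam) ^+ N.
  by apply: lerXn2r; rewrite ?nnegrE ?addr_ge0 ?(ltW lam_gt0) // lerDr.
apply: le_trans (ler_wpM2l _ h2) _; first by rewrite subr_ge0.
by rewrite mulrBl lerD2r ler_wpM2l.
Qed.

Lemma profile_surj y : 0 <= y -> exists a, 0 <= a /\ prof a = y.
Proof.
move=> y0; have lN : 0 < lam ^+ N by exact: exprn_gt0.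
(* By the slope bound the profile has already reached [y] at this point, which closes the interval
   for the intermediate value theorem. *)
have b0 : 0 <= y / lam ^+ N by rewrite divr_ge0 // ltW.
have cf : continuous prof.
  move=> z; apply: cvgM; first exact: cvg_id.
  apply: (@continuous_cvg _ R R _ _ _ (@GRing.exp R ^~ N)).
    exact: exprn_continuous.
  by apply: cvgD; [exact: cvg_id|exact: cvg_cst].
have f0 : prof 0 = 0 by rewrite /prof mul0r.
have fy : y <= prof (y / lam ^+ N).
  by have := profile_increase (lexx 0) b0; rewrite f0 !subr0 divfK ?gt_eqF.
have [||c] := @IVT _ prof 0 (y / lam ^+ N) y b0.
- exact: continuous_subspaceT.
- by rewrite f0 min_l ?max_r ?y0 // (le_trans y0).
by rewrite in_itv /= => /andP[c0 _] pc; exists c.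
Qed.

(* The value of [|w_1|^q] on the balanced manifold, read off from the product [x]:
   there [|x|^q = a (a + lam)^N] with [a = |w_1|^q] and [N = L - 1]. *)
Definition first_mass x : R := xget 0 [set a | 0 <= a /\ a * (a + lam) ^+ N = `|x| `^ q].

Lemma first_massP x : 0 <= first_mass x /\
  first_mass x * (first_mass x + lam) ^+ N = `|x| `^ q.
Proof.
have [a aP] := profile_surj (powR_ge0 `|x| q).
exact: (@xgetI _ 0 [set a | 0 <= a /\ a * (a + lam) ^+ N = `|x| `^ q] a aP).
Qed.

Lemma first_mass_lipschitz x y :
  `|first_mass x - first_mass y| * lam ^+ N <= `| `|x| `^ q - `|y| `^ q|.
Proof.
have [ax ex] := first_massP x; have [ay ey] := first_massP y.
wlog yx : x y ax ay ex ey / first_mass y <= first_mass x.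
  move=> H; have [h|/ltW h] := leP (first_mass y) (first_mass x); first exact: H.
  by rewrite distrC (distrC (`|x| `^ q)); apply: H.
rewrite ger0_norm ?subr_ge0 //; apply: le_trans (profile_increase ay yx) _.
by rewrite /prof ex ey ler_norm.
Qed.

Lemma first_mass_uniq x a : 0 <= a -> a * (a + lam) ^+ N = `|x| `^ q ->
  first_mass x = a.
Proof.
move=> a0 ea; have [b0 eb] := first_massP x.
have lN : 0 < lam ^+ N by exact: exprn_gt0.
have [h|h] := leP a (first_mass x).
  have := profile_increase a0 h; rewrite /prof ea eb subrr.
  by rewrite pmulr_lle0 // subr_le0 => h'; apply/eqP; rewrite eq_le h h'.
have := profile_increase b0 (ltW h); rewrite /prof ea eb subrr.
by rewrite pmulr_lle0 // subr_le0 leNgt h.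
Qed.

Lemma first_mass_continuous : continuous first_mass.
Proof.
have lN : 0 < lam ^+ N by exact: exprn_gt0.
have q0 : 0 < q by exact: lt_le_trans q_ge1.
move=> x; apply/cvgrPdist_le => /= eps eps0.
have e1 : 0 < eps * lam ^+ N by exact: mulr_gt0.
have /cvgrPdist_le /(_ _ e1) := continuous_normr_powR q0 (x := x).
apply: filterS => y h.
by rewrite -(ler_pM2r lN); apply: le_trans (first_mass_lipschitz x y) h.
Qed.

(* [sum_i |P_i|^q] on the balanced manifold, where [P_i] is the product of the
   factors other than the [i]-th: the rate at which [x] moves. *)
Definition mirror_speed x : R :=
  (first_mass x + lam) ^+ N.-1 * (N.+1%:R * first_mass x + lam).

Lemma mirror_speed_gt0 x : 0 < mirror_speed x.
Proof.
have [a0 _] := first_massP x.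
by rewrite mulr_gt0 ?exprn_gt0 ?ltr_wpDl // mulr_ge0.
Qed.

Lemma mirror_speedV_continuous : continuous (fun x => (mirror_speed x)^-1).
Proof.
move=> x; apply: cvgV; first by rewrite gt_eqF // mirror_speed_gt0.
apply: cvgM.
  apply: (@continuous_cvg _ R R _ _ _ (@GRing.exp R ^~ N.-1)).
    exact: exprn_continuous.
  by apply: cvgD; [exact: first_mass_continuous|exact: cvg_cst].
apply: cvgD; last exact: cvg_cst.
by apply: cvgM; [exact: cvg_cst|exact: first_mass_continuous].
Qed.

(** With [a] the first mass, the speed is at most [N.+1] times [K = (a + lam) ^+ N]. If [a < lam],
    then [K] is at most [(2 * lam) ^+ N]. Otherwise [(a + lam) ^+ N.+1] is at most twice the power
    [q] of [|x|], so [K ^+ N.+1] grows at most like the power [q * N] of [1 + |x|], and [q * N] is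
    at most [N + 1]. *)
Lemma mirror_speed_linear_growth : (0 < N)%N -> q * N%:R / N.+1%:R <= 1 ->
  exists2 C : R, 0 < C & forall x, mirror_speed x <= C * (1 + `|x|).
Proof.
move=> N0; rewrite ler_pdivrMr ?ltr0n // mul1r => qN.
pose K x := (first_mass x + lam) ^+ N.
have speedK x : mirror_speed x <= N.+1%:R * K x.
  have [a0 _] := first_massP x.
  rewrite /K -{2}(prednK N0) exprSr mulrCA ler_wpM2l ?exprn_ge0 ?addr_ge0 ?(ltW lam_gt0) //.
  by rewrite mulrDr lerD2l ler_peMl ?ler1n // ltW.
have Kle x : K x <= (2 * lam) ^+ N + 2 * (1 + `|x|).
  have [a0 ea] := first_massP x; have x1 : 1 <= 1 + `|x| by rewrite lerDl.
  have l0 := ltW lam_gt0.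
  have l2 : 0 <= (2 * lam) ^+ N by rewrite exprn_ge0 // mulr_ge0.
  have [al|/ltW la] := leP (first_mass x) lam.
    apply: le_trans (_ : (2 * lam) ^+ N <= _); last by rewrite lerDl; lra.
    by apply: lerXn2r; rewrite ?nnegrE; lra.
  apply: le_trans (_ : 2 * (1 + `|x|) <= _); last by rewrite lerDr.
  have K0 : 0 <= K x by rewrite exprn_ge0 // addr_ge0.
  have b0 : 0 <= 2 * (1 + `|x|) by lra.
  rewrite -(ler_pXn2r (ltn0Sn N)) ?nnegrE //.
  rewrite /K -exprM mulnC exprM.
  apply: le_trans (_ : (2 * `|x| `^ q) ^+ N <= _).
    apply: lerXn2r; rewrite ?nnegrE ?mulr_ge0 ?powR_ge0 ?exprn_ge0 ?addr_ge0 //.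
    rewrite exprS -ea mulrA ler_wpM2r ?exprn_ge0 ?addr_ge0 //; lra.
  rewrite !exprMn; apply: ler_pM; rewrite ?exprn_ge0 ?powR_ge0 //.
    by rewrite exprS ler_peMl ?exprn_ge0 //; lra.
  rewrite -powR_mulrn ?powR_ge0 // -powRrM -powR_mulrn; last lra.
  apply: le_trans (_ : (1 + `|x|) `^ (q * N%:R) <= _).
    apply: ge0_ler_powR; rewrite ?nnegrE ?mulr_ge0 ?(le_trans _ q_ge1) //; lra.
  exact: ler_powR.
exists (N.+1%:R * ((2 * lam) ^+ N + 2)).
  by rewrite mulr_gt0 ?ltr0n // ltr_wpDl // exprn_ge0 // mulr_ge0 // ltW.
move=> x; apply: le_trans (speedK x) _; rewrite -mulrA ler_wpM2l //.
apply: le_trans (Kle x) _; rewrite [leRHS]mulrDl lerD2r ler_peMr ?lerDl //.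
by rewrite exprn_ge0 // mulr_ge0 // ltW.
Qed.

End MirrorSpeed.

(** For [N = 1] the speed is [2 * a + lam], whose square is [4 * (a * (a + lam)) + lam ^+ 2]; the
    defining equation of [a] replaces [a * (a + lam)]. *)
Lemma mirror_speed1 (R : realType) (lam q x : R) : 0 < lam ->
  mirror_speed lam q 1 x = Num.sqrt (4 * `|x| `^ q + lam ^+ 2).
Proof.
move=> lam0; rewrite /mirror_speed /= expr0 mul1r.
have [a0 <-] := first_massP q 1 lam0 x; rewrite expr1.
rewrite (_ : 4 * _ + _ = (2 * first_mass lam q 1 x + lam) ^+ 2); last by ring.
by rewrite sqrtr_sqr ger0_norm // addr_ge0 ?(ltW lam0) // mulr_ge0.
Qed.

(** * Separable potentials *)

Section SeparablePotential.
Context {R : realType} {n : nat}.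
Variables (r th h : R -> R).
Hypotheses (dr : forall y : R, is_derive y 1 r (th y))
           (dth : forall y : R, is_derive y 1 th (h y))
           (h_gt0 : forall y, 0 < h y).
Implicit Types (x y : 'rV[R]_n) (u v : R) (k l : 'I_n).

Definition sep_sum x : R := \sum_l r (x 0 l).

Lemma is_derive_coord (F f : R -> R) x k l : (forall y : R, is_derive y 1 F (f y)) ->
  is_derive x (e k) (fun z : 'rV[R]_n => F (z 0 l)) (if k == l then f (x 0 l) else 0).
Proof.
move=> dF; case: eqVneq => [<-|kl].
  have [dF1 dF2] := dF (x 0 k).
  have E : (fun c : R => c^-1 *: (((fun z : 'rV[R]_n => F (z 0 k)) \o shift x) (c *: e k) - F (x 0 k)))
     = (fun c : R => c^-1 *: ((F \o shift (x 0 k)) (c *: 1) - F (x 0 k))).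
    by apply/funext => c; rewrite /= !mxE !eqxx.
  by split; [rewrite /derivable E|rewrite /derive E].
have E : (fun c : R => c^-1 *: (((fun z : 'rV[R]_n => F (z 0 l)) \o shift x) (c *: e k) - F (x 0 l)))
     = (fun c : R => 0).
  apply/funext => c; rewrite /= !mxE eqxx (eq_sym l) (negPf kl) mulr0 add0r.
  by rewrite subrr scaler0.
split; [rewrite /derivable E; exact: is_cvg_cst|rewrite /derive E].
exact: lim_cst.
Qed.

Lemma sep_sumE : sep_sum = \sum_l (fun x : 'rV[R]_n => r (x 0 l)).
Proof. by apply/funext => x; rewrite fct_sumE. Qed.

Lemma sep_sum_differentiable x : differentiable sep_sum x.
Proof.
rewrite sep_sumE; apply: differentiable_sum => l.
apply: (@differentiable_comp _ _ _ _ (fun z : 'rV[R]_n => z 0 l) r).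
  exact: differentiable_coord.
by apply/derivable1_diffP; have [] := dr (x 0 l).
Qed.

Lemma partial_sep_sum k : partial k sep_sum = fun x => th (x 0 k).
Proof.
apply/funext => x; rewrite /partial sep_sumE.
have := is_derive_sum (fun l => is_derive_coord x k l dr).
move=> [_ ->]; rewrite (bigD1 k) //= eqxx big1 ?addr0 // => l lk.
by rewrite eq_sym (negPf lk).
Qed.

Lemma grad_sep_sum x k : grad sep_sum x 0 k = th (x 0 k).
Proof. by rewrite mxE partial_sep_sum. Qed.

Lemma continuous_coord_comp (F : R -> R) k : continuous F ->
  continuous (fun x : 'rV[R]_n => F (x 0 k)).
Proof.
move=> cF x; apply: (@continuous_comp _ R R (fun z : 'rV[R]_n => z 0 k) F x).
  exact: coord_continuous.
exact: cF.
Qed.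

Definition breg1 u v : R := r u - r v - th v * (u - v).

Lemma bregman_div_sep_sum x y :
  bregman_div sep_sum x y = \sum_k breg1 (x 0 k) (y 0 k).
Proof.
rewrite /bregman_div /sep_sum -!sumrB; apply: eq_bigr => k _.
by rewrite grad_sep_sum.
Qed.

Lemma breg1uu u : breg1 u u = 0.
Proof. by rewrite /breg1 !subrr mulr0 subr0. Qed.

(** The two [th v] terms cancel. The divergence thus falls until [u] and rises afterwards, which
    yields both positivity and coercivity. *)
Lemma is_derive_breg1 u v : is_derive v 1 (breg1 u) (h v * (v - u)).
Proof.
have d1 := is_deriveB (is_derive_cst (r u) v 1) (dr v).
have d2 := is_deriveM (dth v) (is_deriveB (is_derive_cst u v 1) (is_derive_id v 1)).
apply: is_derive_eq (is_deriveB d1 d2) _.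
by rewrite /GRing.scale /= ?fctE; ring.
Qed.

Lemma breg1_gt0 u v : u != v -> 0 < breg1 u v.
Proof.
move=> uv; have [c cuv] := MVT_line_strict (is_derive_breg1 u) uv.
rewrite breg1uu subr0 => ->; rewrite -mulrA; apply: mulr_gt0 => //.
by case/orP: cuv => /andP[uc cv]; [|rewrite -mulrNN]; apply: mulr_gt0; lra.
Qed.

Lemma breg1_ge0 u v : 0 <= breg1 u v.
Proof.
by have [->|uv] := eqVneq u v; [rewrite breg1uu|apply/ltW/breg1_gt0].
Qed.

(** The linear terms of the two divergences cancel in the average, so convexity reduces to
    positivity of [breg1]. *)
Lemma convex_gap u v t : t * r u + (1 - t) * r v - r (t * u + (1 - t) * v) =
  t * breg1 u (t * u + (1 - t) * v) + (1 - t) * breg1 v (t * u + (1 - t) * v).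
Proof. by rewrite /breg1; ring. Qed.

Lemma convex1 u v t : 0 <= t <= 1 ->
  r (t * u + (1 - t) * v) <= t * r u + (1 - t) * r v.
Proof.
move=> /andP[t0 t1]; rewrite -subr_ge0 convex_gap.
by rewrite addr_ge0 // mulr_ge0 ?breg1_ge0 // subr_ge0.
Qed.

Lemma strictly_convex1 u v t : u != v -> 0 < t < 1 ->
  r (t * u + (1 - t) * v) < t * r u + (1 - t) * r v.
Proof.
move=> uv /andP[t0 t1]; rewrite -subr_gt0 convex_gap.
apply: ltr_pwDl; last by rewrite mulr_ge0 ?breg1_ge0 // subr_ge0 ltW.
apply: mulr_gt0 => //; apply: breg1_gt0.
rewrite -subr_eq0 (_ : u - _ = (1 - t) * (u - v)); last by ring.
by rewrite mulf_neq0 // subr_eq0 // eq_sym lt_eqF.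
Qed.

Lemma sep_sum_convex : convex_fun sep_sum.
Proof.
move=> x y t t01; rewrite /sep_sum !mulr_sumr -big_split /=.
by apply: ler_sum => k _; rewrite !mxE; exact: convex1.
Qed.

Lemma sep_sum_strictly_convex : strictly_convex sep_sum.
Proof.
move=> x y t xy t01.
have [k xyk] : exists k, x 0 k != y 0 k.
  apply/existsP; apply: contraNT xy; rewrite negb_exists => /forallP xy.
  by apply/eqP/rowP => k; move: (xy k); rewrite negbK => /eqP.
rewrite /sep_sum !mulr_sumr -big_split /= (bigD1 k) //= [ltRHS](bigD1 k) //=.
apply: ltr_leD; first by rewrite !mxE; exact: strictly_convex1.
apply: ler_sum => l _; rewrite !mxE; apply: convex1.
by case/andP: t01 => /ltW -> /ltW ->.
Qed.

Lemma sep_sum_legendre : legendre sep_sum.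
Proof.
split; first exact: sep_sum_differentiable.
by split; [exact: sep_sum_convex|exact: sep_sum_strictly_convex].
Qed.

(** Once [|c|] is at least [2 * |u| + 1], the slope of [breg1 u] away from the origin is at least
    [(4 * C)^-1]. The divergence is nonnegative where this region starts, so it exceeds [|g|] after
    a further distance [4 * C * |g|]. *)
Lemma breg1_coercive (C : R) u v (g : R) : 0 < C ->
  (forall z : R, (C * (1 + `|z|))^-1 <= h z) ->
  breg1 u v <= g -> `|v| <= 2 * `|u| + 1 + 4 * C * `|g|.
Proof.
move=> C0 hC ug; rewrite leNgt; apply/negP => vbig.
have uge := normr_ge0 u; have gge := normr_ge0 g.
have Cg : 0 <= 4 * C * `|g| by rewrite !mulr_ge0 // ltW.
have step c : 2 * `|u| + 1 <= `|c| -> (4 * C)^-1 <= h c * (`|c| - `|u|).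
  move=> cbig; have c0 : 0 < C * (1 + `|c|) by apply: mulr_gt0; lra.
  apply: le_trans (ler_wpM2r _ (hC c)); last lra.
  rewrite ler_pdivlMl // ler_pdivrMr; last lra.
  by rewrite -subr_ge0 (_ : _ - _ = C * (3 * `|c| - 4 * `|u| - 1)); [apply: mulr_ge0|ring]; lra.
(* The sign [s] of [v] handles both half-lines at once; the mean value theorem is applied between
   [s * Y] and [v]. *)
have lb (s : R) : s = 1 \/ s = -1 -> v = s * `|v| -> False.
  move=> sE vE.
  have s2 : s * s = 1 by case: sE => ->; ring.
  have sn (z : R) : 0 <= z -> `|s * z| = z.
    move=> z0; case: sE => ->; first by rewrite mul1r ger0_norm.
    by rewrite mulN1r normrN ger0_norm.
  pose Y := 2 * `|u| + 1.
  have [c cuv E] := MVT_line (s * Y) v (is_derive_breg1 u).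
  have [c0 [cY ccE]] : 0 <= s * c /\ Y <= s * c /\ `|c| = s * c.
    have H : Y <= s * c.
      rewrite vE in cuv; rewrite /Y in cuv *.
      by case: sE cuv => -> /orP[] /andP[]; rewrite ?mul1r ?mulN1r; lra.
    have H0 : 0 <= s * c by apply: le_trans H; rewrite /Y; lra.
    by split => //; split => //; rewrite -(sn _ H0) mulrA s2 mul1r.
  have hc := step c; rewrite ccE in hc; have {}hc := hc cY.
  have cu : s * c - `|u| <= s * (c - u).
    rewrite mulrBr lerD2l lerN2.
    by case: sE => ->; rewrite ?mul1r ?mulN1r ?ler_norm // -normrN ler_norm.
  have E2 : breg1 u v - breg1 u (s * Y) = (h c * (s * (c - u))) * (`|v| - Y).
    by rewrite E (_ : v - s * Y = s * (`|v| - Y)); [ring|rewrite {1}vE mulrBr].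
  have b0 := breg1_ge0 u (s * Y).
  have vY : 4 * C * `|g| < `|v| - Y by rewrite /Y; lra.
  have : (4 * C)^-1 * (`|v| - Y) <= breg1 u v.
    rewrite -[leRHS](subrK (breg1 u (s * Y))) E2.
    apply: le_trans (_ : (h c * (s * (c - u))) * (`|v| - Y) <= _); last by rewrite lerDl.
    apply: ler_wpM2r; first by lra.
    by apply: le_trans hc _; apply: ler_wpM2l => //; exact: ltW.
  rewrite ler_pdivrMl; last lra.
  move=> H; have := le_trans (ltW vY) H.
  have : 4 * C * breg1 u v <= 4 * C * `|g|.
    by apply: ler_wpM2l; [lra|apply: le_trans ug (ler_norm g)].
  lra.
have [v0|v0] := leP 0 v.
  by apply: (lb 1); [left|rewrite mul1r ger0_norm].
by apply: (lb (-1)); [right|rewrite mulN1r ltr0_norm // opprK].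
Qed.

Lemma sep_sum_bregman (C : R) : 0 < C ->
  (forall z : R, (C * (1 + `|z|))^-1 <= h z) -> bregman_fun sep_sum.
Proof.
move=> C0 hC.
have cr := is_derive1_continuous dr; have cth := is_derive1_continuous dth.
split; first exact: sep_sum_strictly_convex.
split; first by move=> x; apply/differentiable_continuous/sep_sum_differentiable.
split; first exact: sep_sum_differentiable.
split; first by move=> k; rewrite partial_sep_sum; exact: continuous_coord_comp.
split.
  (* Each one-variable divergence is at most the total, as the others are nonnegative; summing the
     coordinate bounds makes the bound independent of [k]. *)
  move=> x g; exists (\sum_k (2 * `|x 0 k| + 1 + 4 * C * `|g|)) => y yg k.
  have pos l : 0 <= 2 * `|x 0 l| + 1 + 4 * C * `|g|.
    by rewrite !addr_ge0 ?mulr_ge0 // ltW.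
  apply: le_trans (_ : 2 * `|x 0 k| + 1 + 4 * C * `|g| <= _).
    apply: breg1_coercive => //; apply: le_trans yg.
    rewrite bregman_div_sep_sum (bigD1 k) //= lerDl.
    by apply: sumr_ge0 => l _; exact: breg1_ge0.
  by rewrite (bigD1 k) //= lerDl; apply: sumr_ge0.
move=> x s sx.
rewrite (_ : (fun i => _) = (fun i => \sum_k breg1 (x 0 k) (s i 0 k))); last first.
  by apply/funext => i; rewrite bregman_div_sep_sum.
rewrite -[X in _ --> X](_ : \sum_k breg1 (x 0 k) (x 0 k) = 0); last first.
  by apply: big1 => k _; rewrite breg1uu.
apply: cvg_big => [|k _]; first exact: add_continuous.
apply: (@continuous_cvg _ _ R _ _ s (fun z : 'rV[R]_n => breg1 (x 0 k) (z 0 k))) => //.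
exact: continuous_coord_comp (is_derive1_continuous (is_derive_breg1 (x 0 k))) x.
Qed.

Lemma hessian_sep_sum x k l : derivable (partial l sep_sum) x (e k) /\
  partial k (partial l sep_sum) x = if k == l then h (x 0 k) else 0.
Proof.
rewrite partial_sep_sum; have [d1 d2] := is_derive_coord x k l dth.
by split=> //; rewrite /partial d2; case: eqP => // ->.
Qed.

End SeparablePotential.

(** * The steepest flow *)

Section Gradient.
Context {R : realType} {n : nat}.
Implicit Types (f : 'rV[R]_n -> R) (ws : nat -> 'rV[R]_n).

Lemma steepE (q : R) (g : 'rV[R]_n) k : steep q g 0 k = - spow (q - 1) (g 0 k).
Proof. by rewrite mxE. Qed.

Lemma gradE f x k : grad f x 0 k = partial k f x.
Proof. by rewrite mxE. Qed.

(** The product is affine in each factor, and a move of [ws i] along [e k] affects coordinate [k]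
    only. *)
Lemma hprod_update L ws i (k : 'I_n) (c : R) : (i < L)%N ->
  hprod L (fun j => if j == i then c *: e k + ws i else ws j) =
  c *: ((\prod_(j < L | j != i :> nat) ws j 0 k) *: e k) + hprod L ws.
Proof.
move=> iL; apply/rowP => l; rewrite !mxE.
have neqE (j : 'I_L) : (j != Ordinal iL) = (j != i :> nat) by rewrite -val_eqE.
rewrite [LHS](bigD1 (Ordinal iL)) //= [X in _ = _ + X](bigD1 (Ordinal iL)) //=.
rewrite !eqxx !mxE eqxx /=.
rewrite (eq_bigr (fun j : 'I_L => ws j 0 l)); last first.
  by move=> j; rewrite neqE => /negPf ->.
rewrite (eq_bigl _ _ neqE) mulrDl.
by case: eqVneq => [->|_]; rewrite ?mulr1 // !mulr0 mul0r.
Qed.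

(** By affinity the difference quotient is literally that of [f] in direction [P *: e k]; linearity
    of the differential extracts [P], also when [P = 0]. *)
Lemma gradFE f L ws i (k : 'I_n) : (i < L)%N ->
  differentiable f (hprod L ws) ->
  gradF f L ws i 0 k =
    partial k f (hprod L ws) * \prod_(j < L | j != i :> nat) ws j 0 k.
Proof.
move=> iL df; set P := \prod_(j < L | _) _.
have -> : gradF f L ws i 0 k = 'D_(P *: e k) f (hprod L ws).
  have E : (fun c : R => c^-1 *: (((fun v => f (hprod L
          (fun j => if j == i then v else ws j))) \o shift (ws i)) (c *: e k) -
        f (hprod L (fun j => if j == i then ws i else ws j)))) =
      (fun c : R => c^-1 *: ((f \o shift (hprod L ws)) (c *: (P *: e k)) -
        f (hprod L ws))).
    apply/funext => c /=; rewrite hprod_update // -/P; congr (_ *: (_ - f _)).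
    by congr (hprod L _); apply/funext => j; case: eqP => // ->.
  by rewrite mxE /partial /derive E.
by rewrite /partial !deriveE // linearZ /= mulrC.
Qed.

End Gradient.

(** * Products and coproducts of balanced masses *)

Section BalancedProducts.
Context {R : realType}.

Lemma normr_prod_powR (q : R) (m : nat) (P : pred 'I_m) (u : 'I_m -> R) :
  `|\prod_(j < m | P j) u j| `^ q = \prod_(j < m | P j) `|u j| `^ q.
Proof.
by apply: (big_morph (fun z => `|z| `^ q)) => [x y|]; rewrite ?normrM ?powRM ?normr1 ?powR1.
Qed.

(** Omitting the first factor leaves [(a + lam) ^+ N]; each of the [N] other omissions leaves
    [a * (a + lam) ^+ N.-1]. *)
Lemma sum_coproducts (N : nat) (a lam : R) (m : nat -> R) : (0 < N)%N -> m 0%N = a ->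
  (forall j, (0 < j < N.+1)%N -> m j = a + lam) ->
  \sum_(i < N.+1) \prod_(j < N.+1 | j != i :> nat) m j =
  (a + lam) ^+ N.-1 * (N.+1%:R * a + lam).
Proof.
move=> N0 m0 mj.
have mS (j : 'I_N) : m (lift ord0 j) = a + lam by apply: mj; rewrite /= ltnS ltn_ord.
rewrite big_ord_recl /= big_mkcond big_ord_recl /= mul1r.
rewrite (eq_bigr (fun=> a + lam)) => [|j _]; last by rewrite mS.
rewrite prodr_const card_ord.
rewrite (eq_bigr (fun=> a * (a + lam) ^+ N.-1)) => [|i _].
  rewrite sumr_const card_ord -mulr_natl -{1}(prednK N0) exprSr.
  by rewrite -[in RHS]natr1; ring.
rewrite big_mkcond big_ord_recl /= m0; congr (_ * _).
have <- : #|predC1 i| = N.-1 by rewrite cardC1 card_ord.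
rewrite -prodr_const [RHS]big_mkcond /=.
apply: eq_bigr => j _; rewrite -(mS j) inE -val_eqE /= /bump /= !add1n eqSS.
by [].
Qed.

Lemma prod_balanced (N : nat) (a lam : R) (m : nat -> R) : m 0%N = a ->
  (forall j, (0 < j < N.+1)%N -> m j = a + lam) ->
  \prod_(j < N.+1) m j = a * (a + lam) ^+ N.
Proof.
move=> m0 mj; rewrite big_ord_recl /= m0; congr (_ * _).
rewrite (eq_bigr (fun=> a + lam)) => [|j _]; first by rewrite prodr_const card_ord.
by apply: mj; rewrite /= ltnS ltn_ord.
Qed.

End BalancedProducts.

(** * From the steepest flow to the mirror flow *)

Section Flow.
Context {R : realType} {n : nat}.
Notation mu := (@lebesgue_measure R).
Variables (q : R) (f : 'rV[R]_n -> R) (L : nat) (w : nat -> R -> 'rV[R]_n) (t0 : R).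
Hypotheses (q_ge1 : 1 <= q) (C1f : C1 f) (t0_ge0 : 0 <= t0).
Hypothesis flow : forall (i : nat) (k : 'I_n), (i < L)%N -> forall t, 0 <= t <= t0 ->
  mu.-integrable `[0, t]
    (EFin \o (fun s => steep q (gradF f L (fun j => w j s) i) 0 k)) /\
  w i t 0 k = w i 0 0 k +
    \int[mu]_(s in `[0, t]) steep q (gradF f L (fun j => w j s) i) 0 k.

Let x t := hprod L (fun j => w j t).
Let phi k s := steep q (grad f (x s)) 0 k.
Let cop k i s : R := \prod_(j < L | j != i :> nat) w j s 0 k.

Lemma steep_gradFE i k s : (i < L)%N ->
  steep q (gradF f L (fun j => w j s) i) 0 k = phi k s * spow (q - 1) (cop k i s).
Proof.
move=> iL; have [df _] := C1f.
have h1 := steepE q (gradF f L (fun j => w j s) i) k.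
have h2 := steepE q (grad f (x s)) k.
have h3 := gradFE (ws := fun j => w j s) k iL (df _).
have h4 := gradE f (x s) k.
apply: (etrans h1); rewrite h3 spowM -mulNr; congr (_ * _).
by rewrite /phi h2 h4.
Qed.

(** Start of a bootstrap: the velocity is only known to be integrable, which already makes the
    factors continuous. *)
Lemma flow_continuous i k : (i < L)%N ->
  {within `[0, t0], continuous (fun s => w i s 0 k)}.
Proof.
move=> iL; have t0t0 : 0 <= t0 <= t0 by rewrite t0_ge0 lexx.
have [it0 _] := flow k iL t0t0.
pose I t := w i 0 0 k +
  parameterized_integral mu 0 t (fun s => steep q (gradF f L (fun j => w j s) i) 0 k).
apply: (@subspace_eq_continuous _ _ _ I).
  by move=> t; rewrite inE /= in_itv /= => /(flow k iL)[_ H]; exact: esym H.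
move=> t; apply: cvgD; first exact: cvg_cst.
exact: (parameterized_integral_continuous t0_ge0 it0).
Qed.

Lemma within_continuous_prod (P : pred 'I_L) k :
  {within `[0, t0], continuous (fun s => \prod_(j < L | P j) w j s 0 k)}.
Proof.
move=> s; apply: cvg_big => [|j _]; first exact: mul_continuous.
exact: (@flow_continuous j k (ltn_ord j) s).
Qed.

Lemma flow_product_continuous : {within `[0, t0], continuous x}.
Proof.
rewrite (_ : x = fun s => \sum_(l < n) x s 0 l *: delta_mx 0 l); last first.
  by apply/funext => s; exact: row_sum_delta.
move=> s; apply: cvg_big => [|l _]; first exact: add_continuous.
apply: cvgZr_tmp; rewrite (_ : (fun s => _) = fun s => \prod_(j < L) w j s 0 l).
  rewrite mxE; exact: (@within_continuous_prod xpredT l s).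
by apply/funext => r; rewrite mxE.
Qed.

(** Second half of the bootstrap: the product is continuous on a compact interval, so the gradient
    of [f] along it is bounded, and the factors acquire bounded densities. *)
Lemma velocity_measurable_bounded k : measurable_fun `[0, t0] (phi k) /\
  exists M, forall s, 0 <= s <= t0 -> `|phi k s| <= M.
Proof.
have cg : {within `[0, t0], continuous (partial k f \o x)}.
  have [_ cf] := C1f; move=> s.
  apply: (@continuous_comp (subspace `[0, t0]) 'rV[R]_n R x (partial k f) s).
    exact: flow_product_continuous.
  exact: cf.
have phiE s : phi k s = - spow (q - 1) (partial k f (x s)) by rewrite /phi steepE gradE.
split.
  rewrite (_ : phi k = fun s => - spow (q - 1) (partial k f (x s))); last exact/funext.
  apply: measurableT_comp => //.
  apply: (measurableT_comp (measurable_spow _)).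
  exact: within_continuous_measurable.
have [M gM] := continuous_itvcc_bounded cg.
exists (M `^ (q - 1)) => s st; rewrite phiE normrN.
apply: le_trans (normr_spow_le _ _) _.
apply: ge0_ler_powR; rewrite ?nnegrE ?(le_trans _ (gM s st)) ?gM //.
by rewrite subr_ge0.
Qed.

Lemma flow_density i k : (i < L)%N ->
  density t0 (fun s => w i s 0 k) (fun s => phi k s * spow (q - 1) (cop k i s)).
Proof.
move=> iL; have [mphi [M phiM]] := velocity_measurable_bounded k.
have ccop : {within `[0, t0], continuous (cop k i)} by exact: within_continuous_prod.
split.
- apply: measurable_funM => //.
  apply: (measurableT_comp (measurable_spow _)).
  exact: within_continuous_measurable.
- have [B copB] := continuous_itvcc_bounded ccop.
  exists (M * B `^ (q - 1)) => s st; rewrite normrM.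
  apply: ler_pM; rewrite ?normr_ge0 ?phiM //.
  apply: le_trans (normr_spow_le _ _) _.
  apply: ge0_ler_powR; rewrite ?nnegrE ?(le_trans _ (copB s st)) ?copB //.
  by rewrite subr_ge0.
- move=> t tt; have [_ ->] := flow k iL tt; congr (_ + _).
  by apply: eq_Rintegral => s _; rewrite steep_gradFE.
Qed.

Lemma mul_cop i k s : (i < L)%N -> w i s 0 k * cop k i s = x s 0 k.
Proof.
by move=> iL; rewrite mxE (bigD1 (Ordinal iL)).
Qed.

(* [|w_i|^q] has density [q phi spow (q-1) x], the same for all layers [i]. *)
Lemma balance_preserved i j k t : (i < L)%N -> (j < L)%N -> 0 <= t <= t0 ->
  `|w i t 0 k| `^ q - `|w j t 0 k| `^ q = `|w i 0 0 k| `^ q - `|w j 0 0 k| `^ q.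
Proof.
move=> iL jL tt.
have dq m : (m < L)%N -> density t0 (fun s => `|w m s 0 k| `^ q)
    (fun s => q * phi k s * spow (q - 1) (x s 0 k)).
  move=> mL; apply: density_ext (density_normr_powR q_ge1 (flow_density k mL)) _ _ => // s _.
  by rewrite -(mul_cop k s mL) spowM; ring.
have [_ _ /(_ t tt) ->] := dq i iL; have [_ _ /(_ t tt) ->] := dq j jL.
by ring.
Qed.

(** The product moves at rate [phi] times [mirror_speed], and the derivative of [th] is the inverse
    of that speed, so the two cancel in the chain rule. *)
Lemma mirror_flow (lam : R) (th : R -> R) k : (1 < L)%N -> 0 < lam ->
  (forall j, (1 <= j < L)%N -> `|w j 0 0 k| `^ q - `|w 0%N 0 0 k| `^ q = lam) ->
  (forall y : R, is_derive y 1 th (mirror_speed lam q L.-1 y)^-1) ->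
  density t0 (fun t => th (x t 0 k)) (phi k).
Proof.
move=> L1 lam0 bal0 dth; have L0 := ltnW L1.
have bal s j : 0 <= s <= t0 -> (0 < j < L)%N ->
    `|w j s 0 k| `^ q = `|w 0%N s 0 k| `^ q + lam.
  move=> st /andP[j0 jL]; rewrite -(bal0 j) ?j0 //.
  by rewrite -(balance_preserved k jL L0 st) addrC subrK.
have massE s : 0 <= s <= t0 ->
    first_mass lam q L.-1 (x s 0 k) = `|w 0%N s 0 k| `^ q.
  move=> st; apply: first_mass_uniq; rewrite ?powR_ge0 //.
  rewrite mxE normr_prod_powR -(prednK L0) /=.
  rewrite (@prod_balanced _ L.-1 (`|w 0%N s 0 k| `^ q) lam (fun j => `|w j s 0 k| `^ q)) //.
  by move=> j; rewrite (prednK L0); exact: bal.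
(* In the product rule each coproduct meets its own [spow (q - 1)], giving the power [q] of its
   absolute value; the preserved balance evaluates the sum. *)
have dx : density t0 (fun s => x s 0 k)
    (fun s => phi k s * mirror_speed lam q L.-1 (x s 0 k)).
  apply: density_ext (density_prod (fun i iL => flow_density k iL)) _ _ => s st.
    by rewrite mxE.
  rewrite /mirror_speed massE //.
  have := @sum_coproducts _ L.-1 (`|w 0%N s 0 k| `^ q) lam (fun j => `|w j s 0 k| `^ q).
  rewrite (prednK L0) => <- //; [|by rewrite -ltnS prednK|by move=> j; exact: bal].
  rewrite mulr_sumr; apply: eq_bigr => i _.
  rewrite (_ : \prod_(j < L | j != i) _ = cop k i s); last first.
    by apply: eq_bigl => j; rewrite -val_eqE.
  rewrite mulrCA mulr_spow ?(lt_le_trans _ q_ge1) //; congr (_ * _).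
  by rewrite /cop normr_prod_powR.
apply: density_ext (density_comp dx dth (mirror_speedV_continuous lam0 q_ge1)) _ _ => // s _.
by rewrite mulrCA mulVf ?mulr1 // gt_eqF // mirror_speed_gt0.
Qed.

End Flow.

Theorem theorem3 (R : realType) (n L : nat) (q lambda : R)
  (w0 : nat -> 'rV[R]_n) :
  1 <= q <= 2 -> (2 <= L)%N -> 0 < lambda ->
  (* lambda-L_p-balanced initialization w.r.t. the first parameter w0 0 *)
  (forall j : nat, (1 <= j < L)%N -> forall k : 'I_n,
     `|w0 j 0 k| `^ q - `|w0 0%N 0 k| `^ q = lambda) ->
  exists Rf : 'rV[R]_n -> R,
    separable Rf /\
    (forall x, differentiable Rf x) /\
    (q * (L%:R - 1) / L%:R <= 1 -> bregman_fun Rf /\ legendre Rf) /\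
    (L = 2%N -> forall (x : 'rV[R]_n) (k l : 'I_n),
       derivable (partial l Rf) x (e k) /\
       partial k (partial l Rf) x =
         (if k == l then (Num.sqrt (4 * `|x 0 k| `^ q + lambda ^+ 2))^-1
          else 0)) /\
    (* for every f in C^1 and every solution of the steepest flow started at w0 *)
    (forall (f : 'rV[R]_n -> R) (T : R) (w : nat -> R -> 'rV[R]_n),
       C1 f -> 0 < T ->
       (forall i, w i 0 = w0 i) ->
       (forall (i : nat) (k : 'I_n), (i < L)%N -> forall t, 0 <= t < T ->
          (leb R).-integrable `[0, t]
             (EFin \o (fun s => steep q (gradF f L (fun j => w j s) i) 0 k)) /\
          w i t 0 k = w i 0 0 k +
            \int[leb R]_(s in `[0, t]) steep q (gradF f L (fun j => w j s) i) 0 k) ->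
       (* x_t = prod_i w_{i,t} satisfies the L_p steepest mirror flow *)
       let x := fun t => hprod L (fun j => w j t) in
       forall (k : 'I_n) t, 0 <= t < T ->
          (leb R).-integrable `[0, t] (EFin \o (fun s => steep q (grad f (x s)) 0 k)) /\
          grad Rf (x t) 0 k - grad Rf (x 0) 0 k =
            \int[leb R]_(s in `[0, t]) steep q (grad f (x s)) 0 k).
Proof.
move=> /andP[q1 _] L2 lam0 bal0.
have L0 : (0 < L)%N by exact: ltnW.
have N0 : (0 < L.-1)%N by rewrite -ltnS prednK.
(* [th] is the mirror map in one coordinate and [r] its primitive, a potential with second
   derivative [1 / mirror_speed]. *)
have [th dth] := continuous_primitive (mirror_speedV_continuous (N := L.-1) lam0 q1).
have [r dr] := continuous_primitive (is_derive1_continuous dth).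
have hgt0 y : 0 < (mirror_speed lambda q L.-1 y)^-1.
  by rewrite invr_gt0 mirror_speed_gt0.
(* The balance constant is the same in every coordinate, so one [r] serves them all. *)
exists (sep_sum r); split; first by exists (fun=> r).
split; first exact: sep_sum_differentiable dr.
split.
  (* With [L = N + 1] the hypothesis becomes the growth condition on [mirror_speed]; the linear
     bound on the speed is then the lower bound on the second derivative that coercivity needs. *)
  rewrite -{1 2}(prednK L0) -natr1 addrK natr1 => qL.
  have [C C0 speedC] := mirror_speed_linear_growth lam0 q1 N0 qL.
  split; last exact: sep_sum_legendre dr dth hgt0.
  apply: (sep_sum_bregman dr dth hgt0 C0) => z.
  by rewrite lef_pV2 ?posrE ?mirror_speed_gt0 // mulr_gt0 // ltr_pwDl.
split.
  move=> L2E x k l; have [d1 d2] := hessian_sep_sum dr dth x k l.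
  by split=> //; rewrite d2 L2E /= mirror_speed1.
move=> f T w C1f T0 winit flow x k t /andP[t0 tT].
(* The solution lives on a half-open interval; fixing [t < T] and working on the closed interval up
   to [t] supplies compactness. *)
have dmirror := @mirror_flow R n q f L w t q1 C1f t0 _ lambda th k L2 lam0 _ dth.
have tt : 0 <= t <= t by rewrite t0 lexx.
have {}dmirror : density t (fun s => th (x s 0 k)) (fun s => steep q (grad f (x s)) 0 k).
  apply: dmirror => [i k' iL s /andP[s0 st]|j jL].
    by apply: flow => //; rewrite s0 (le_lt_trans st).
  by rewrite !winit; exact: bal0.
split; first exact: density_integrable dmirror tt.
have [_ _ /(_ t tt) E] := dmirror.
by rewrite !(grad_sep_sum dr) E addrC addKr.
Qed.
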